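(* Let $n\ge1$ and let $0\le i\le j\le n$. Write $p_ip_j=\sum_{k=0}^n c_{ij}^k\,p_k$ in $H^*_T(\mathbb{P}^n;\mathbb{Z})$ with $c_{ij}^k\in\mathbb{Z}[t_0,\ldots,t_n]$. Then the nonzero structure constants $c_{ij}^k$ are exactly $$c_{ij}^j=p_i(x_j)=\prod_{l=0}^{i-1}(t_l-t_j)$$ and, for $j<k\le\min\{i+j,n\}$, $$c_{ij}^k=\partial_{k-1}\partial_{k-2}\cdots\partial_{j+1}\partial_j\,p_i(x_j).$$
   Context: $T=(\mathbb{C}^* )^{n+1}$ acts on $\mathbb{P}^n$ by $(t_0,\ldots,t_n)\cdot[z_0,\ldots,z_n]=[t_0z_0,\ldots,t_nz_n]$, and $H^*_T$ is Borel equivariant cohomology, an algebra over $H^*_T(\mathrm{pt};\mathbb{Z})=\mathbb{Z}[t_0,\ldots,t_n]$. Let $x_k=[e_k]$ be the fixed point with only the $k$-th coordinate nonzero. Restriction to the fixed points identifies $H^*_T(\mathbb{P}^n;\mathbb{Z})$ with the ring of tuples $(p(x_0),\ldots,p(x_n))\in\bigoplus_{k=0}^n\mathbb{Z}[t_0,\ldots,t_n]$ such that $p(x_k)-p(x_l)\in\langle t_k-t_l\rangle$ for all $k<l$ (componentwise operations). The canonical (Schubert) classes $p_0,\ldots,p_n$, given by $p_i(x_k)=\prod_{l=0}^{i-1}(t_l-t_k)$ if $k\ge i$ and $p_i(x_k)=0$ if $k<i$, form a basis of $H^*_T(\mathbb{P}^n;\mathbb{Z})$ over $\mathbb{Z}[t_0,\ldots,t_n]$.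 The divided difference operator $\partial_m$ on polynomials is $$\partial_m p(\ldots,t_m,t_{m+1},\ldots)=\frac{p(\ldots,t_{m+1},t_m,\ldots)-p(\ldots,t_m,t_{m+1},\ldots)}{t_m-t_{m+1}},$$ i.e. the first term in the numerator has the variables $t_m$ and $t_{m+1}$ exchanged. *)

(* Defs.v *)
From HB Require Import structures.
From mathcomp Require Import all_boot all_order all_fingroup all_algebra.
From mathcomp Require Import boolp ring.
From mathcomp.multinomials Require Import mpoly.

Set Implicit Arguments.
Unset Strict Implicit.
Unset Printing Implicit Defensive.

Import GRing.Theory.
Local Open Scope ring_scope.

(* The coefficient ring Z[t_0, ..., t_n] = H^*_T(pt; Z); t_k is 'X_k. *)
Notation HTpt n := {mpoly int[n.+1]}.

Definition in_ideal1 n (g p : HTpt n) : Prop := exists q, p = q * g.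

(* H^*_T(P^n; Z), in its description by restriction to the fixed points
   x_0, ..., x_n: the tuples (p(x_0), ..., p(x_n)) such that p(x_k) - p(x_l)
   lies in the ideal <t_k - t_l> for all k < l.  The (Prop) condition is made
   boolean with classical logic so that the tuples form a subType. *)
Definition gkm n : {pred {ffun 'I_n.+1 -> HTpt n}} :=
  fun p => `[< forall k l : 'I_n.+1, (k < l)%N ->
                 in_ideal1 ('X_k - 'X_l) (p k - p l) >].

Arguments gkm : clear implicits.

Lemma gkmP n (p : {ffun 'I_n.+1 -> HTpt n}) :
  reflect (forall k l : 'I_n.+1, (k < l)%N ->
             in_ideal1 ('X_k - 'X_l) (p k - p l)) (p \in gkm n).
Proof. exact: asboolP. Qed.

Lemma gkm_subring n : subring_closed (gkm n).
Proof.
split.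
- by apply/gkmP => k l _; exists 0; rewrite !ffunE subrr mul0r.
- move=> p q /gkmP hp /gkmP hq; apply/gkmP => k l kl.
  have [a ea] := hp k l kl; have [b eb] := hq k l kl.
  by exists (a - b); rewrite !ffunE mulrBl -ea -eb; ring.
- move=> p q /gkmP hp /gkmP hq; apply/gkmP => k l kl.
  have [a ea] := hp k l kl; have [b eb] := hq k l kl.
  exists (a * q k + p l * b).
  by rewrite !ffunE mulrDl mulrAC -ea -mulrA -eb; ring.
Qed.

HB.instance Definition _ n :=
  GRing.isSubringClosed.Build {ffun 'I_n.+1 -> HTpt n} (gkm n) (@gkm_subring n).

Record HTP n := HTPn { fixpt : {ffun 'I_n.+1 -> HTpt n}; _ : fixpt \in gkm n }.

HB.instance Definition _ n := [isSub for @fixpt n].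
HB.instance Definition _ n := [Choice of HTP n by <:].
HB.instance Definition _ n :=
  GRing.SubChoice_isSubPzRing.Build _ _ (HTP n) (@gkm_subring n).

Lemma HTP_mulC n : commutative (@GRing.mul (HTP n)).
Proof. by move=> p q; apply/val_inj/ffunP => k; rewrite /= !ffunE mulrC. Qed.

HB.instance Definition _ n :=
  GRing.PzRing_hasCommutativeMul.Build (HTP n) (@HTP_mulC n).

(* restr p k is p(x_k). *)
Definition restr n (p : HTP n) (k : 'I_n.+1) : HTpt n := fixpt p k.

Lemma HTP_neq0 n : (1 : HTP n) != 0.
Proof.
apply/eqP => /(congr1 (@fixpt n)) /ffunP /(_ ord0) /eqP.
by rewrite /= !ffunE oner_eq0.
Qed.

HB.instance Definition _ n :=
  GRing.PzSemiRing_isNonZero.Build (HTP n) (@HTP_neq0 n).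

Lemma gkm_scale n (c : HTpt n) (p : HTP n) :
  [ffun k => c * fixpt p k] \in gkm n.
Proof.
case: p => p hp; apply/gkmP => k l kl; have [a ea] := gkmP _ hp k l kl.
by exists (c * a); rewrite !ffunE -mulrBr -mulrA -ea.
Qed.

Definition HTP_scale n (c : HTpt n) (p : HTP n) : HTP n := HTPn (gkm_scale c p).

Lemma HTP_scaleA n (a b : HTpt n) (p : HTP n) :
  HTP_scale a (HTP_scale b p) = HTP_scale (a * b) p.
Proof. by apply/val_inj/ffunP => k; rewrite /= !ffunE /= ?ffunE mulrA. Qed.

Lemma HTP_scale1 n : left_id 1 (@HTP_scale n).
Proof. by move=> p; apply/val_inj/ffunP => k; rewrite /= !ffunE mul1r. Qed.

Lemma HTP_scaleDr n : right_distributive (@HTP_scale n) +%R.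
Proof. by move=> c p q; apply/val_inj/ffunP => k; rewrite /= !ffunE mulrDr. Qed.

Lemma HTP_scaleDl n (p : HTP n) : {morph (@HTP_scale n)^~ p : a b / a + b}.
Proof. by move=> a b; apply/val_inj/ffunP => k; rewrite /= !ffunE mulrDl. Qed.

HB.instance Definition _ n :=
  GRing.Zmodule_isLmodule.Build (HTpt n) (HTP n)
    (@HTP_scaleA n) (@HTP_scale1 n) (@HTP_scaleDr n) (@HTP_scaleDl n).

Lemma HTP_scaleAl n (a : HTpt n) (p q : HTP n) : a *: (p * q) = (a *: p) * q.
Proof. by apply/val_inj/ffunP => k; rewrite /= !ffunE /= ?ffunE mulrA. Qed.

HB.instance Definition _ n :=
  GRing.Lmodule_isLalgebra.Build (HTpt n) (HTP n) (@HTP_scaleAl n).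
HB.instance Definition _ n :=
  GRing.Lalgebra_isComAlgebra.Build (HTpt n) (HTP n).

Lemma restrM n (p q : HTP n) k : restr (p * q) k = restr p k * restr q k.
Proof. by rewrite /restr /= !ffunE. Qed.

Lemma restrD n (p q : HTP n) k : restr (p + q) k = restr p k + restr q k.
Proof. by rewrite /restr /= !ffunE. Qed.

Lemma restrZ n (c : HTpt n) (p : HTP n) k : restr (c *: p) k = c * restr p k.
Proof. by rewrite /restr /= !ffunE. Qed.

Lemma restr_inj n (p q : HTP n) : restr p =1 restr q -> p = q.
Proof. by move=> e; apply/val_inj/ffunP => k; apply: e. Qed.

Definition schubert_tuple n (i : 'I_n.+1) : {ffun 'I_n.+1 -> HTpt n} :=
  [ffun k : 'I_n.+1 =>
     if (i <= k)%N then \prod_(l < n.+1 | (l < i)%N) ('X_l - 'X_k) else 0].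

Lemma schubert_gkm n (i : 'I_n.+1) : schubert_tuple i \in gkm n.
Proof.
apply/gkmP => k l kl; rewrite !ffunE.
case: (leqP i k) => [ik | ki]; last first.
  case: (leqP i l) => [il | _]; last by exists 0; rewrite subrr mul0r.
  rewrite sub0r (bigD1 k) //= mulrC -mulNr; by eexists.
rewrite (leq_trans ik (ltnW kl)).
apply: (big_ind2 (fun a b => in_ideal1 ('X_k - 'X_l) (a - b))).
- by exists 0; rewrite subrr mul0r.
- move=> a b c d [u eu] [v ev]; exists (u * c + b * v).
  by rewrite mulrDl mulrAC -eu -mulrA -ev; ring.
- by move=> m _; exists (-1); ring.
Qed.

Definition schubert n (i : 'I_n.+1) : HTP n := HTPn (schubert_gkm i).

Lemma divdiff_exists n (a b : 'I_n.+1) (p : HTpt n) :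
  exists q, q * ('X_a - 'X_b) == msym (tperm a b) p - p.
Proof.
pose I (p : HTpt n) := exists q, q * ('X_a - 'X_b) = msym (tperm a b) p - p.
suff [q eq] : I p by exists q; apply/eqP.
have I0 : I 0 by exists 0; rewrite mul0r msym0 subrr.
have I1 : I 1 by exists 0; rewrite mul0r msym1 subrr.
have ID r s : I r -> I s -> I (r + s).
  move=> [u eu] [v ev]; exists (u + v).
  by rewrite mulrDl eu ev msymD opprD addrACA.
have IM r s : I r -> I s -> I (r * s).
  move=> [u eu] [v ev]; exists (u * s + msym (tperm a b) r * v).
  by rewrite mulrDl mulrAC eu -mulrA ev msymM; ring.
have IZ c r : I r -> I (c *: r).
  by move=> [u eu]; exists (c *: u); rewrite -scalerAl eu msymZ scalerBr.
have IX (k : 'I_n.+1) : I 'X_k.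
  rewrite /I /msym mmapX mmap1U; case: tpermP => [->|->|_ _].
  - by exists (-1); rewrite mulN1r opprB.
  - by exists 1; rewrite mul1r.
  - by exists 0; rewrite mul0r subrr.
elim/mpolyind: p => // c m r _ _ Ir; apply: ID => //; apply: IZ.
rewrite mpolyXE_id; apply: (big_ind I) => // k _.
by elim: (m k) => [|d IHd]; rewrite ?expr0 // exprS; apply: IM.
Qed.

(* The operator exchanging the variables t_a and t_b, subtracting, and dividing
   by t_a - t_b; the quotient exists (and is unique for a != b, the ring being
   a domain). *)
Definition divdiff2 n (a b : 'I_n.+1) (p : HTpt n) : HTpt n :=
  xchoose (divdiff_exists a b p).

Lemma divdiff2E n (a b : 'I_n.+1) (p : HTpt n) :
  divdiff2 a b p * ('X_a - 'X_b) = msym (tperm a b) p - p.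
Proof. exact/eqP/(xchooseP (divdiff_exists a b p)). Qed.

(* The index m + 1 exists only for m < n; inord sends larger values to 0. *)
Definition divdiff n (m : nat) (p : HTpt n) : HTpt n :=
  divdiff2 (inord m) (inord m.+1) p.

(* divdiffs j k p = d_{k-1} (... (d_{j+1} (d_j p))): d_j is applied first. *)
Definition divdiffs n (j k : nat) (p : HTpt n) : HTpt n :=
  foldl (fun q m => divdiff m q) p (index_iota j k).

(* Main.v *)
Require Import Defs.
From mathcomp Require Import all_boot all_order all_fingroup all_algebra.
From mathcomp Require Import ring zify.
From mathcomp.multinomials Require Import mpoly.

Set Implicit Arguments.
Unset Strict Implicit.
Unset Printing Implicit Defensive.

Import GRing.Theory.
Local Open Scope ring_scope.

(** The class [p_i] is the restriction to the points [x = t_k] of the Newton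
    polynomial [N_i(x) = (t_0 - x) ... (t_(i-1) - x)]; the case distinction in
    its definition is automatic, since [N_i(t_k)] contains the factor
    [t_k - t_k] when [k < i].  So the structure constants are the coefficients
    of [N_i N_j] in the Newton basis.  From
      [(t_i - x) N_k(x) = (t_i - t_k) N_k(x) + N_(k+1)(x)]
    they obey a Pascal-like recursion in [i] with [j] fixed,
      [c_(i+1)^k = (t_i - t_k) c_i^k + c_i^(k-1)],   [c_0^k = [k = j]],
    which is taken here as their definition ([newton_coef]), over any
    commutative ring and any sequence of nodes.  All claims follow by induction
    along this recursion:
    - the expansion holds ([newton_mul]), and on [P^n] it may be cut at [k = n]
      because [N_(n+1)] vanishes at all fixed points;
    - [c_i^k] vanishes unless [j <= k <= i + j], and [c_i^j = N_i(t_j)];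
    - for [i <= j] and [j <= k <= i + j] it is nonzero, because the
      specialization [t_l = 1] for [l < j] and [t_l = 0] for [l >= j] turns the
      recursion into Pascal's rule and [c_i^k] into a binomial coefficient
      ([newton_coef_binomial]);
    - for [i <= j <= k] the operator [d_k] sends [c_i^k] to [c_i^(k+1)]
      ([divdiff_newton_coef]), by the Leibniz rule: the recursion's second term
      does not involve [t_k] and [t_(k+1)].
    The coefficients of an expansion are unique because the matrix [p_k(x_m)]
    is triangular with nonzero diagonal entries. *)

(** * Newton polynomials and their products *)

Section Newton.
Variable R : comPzRingType.
Implicit Types (t : nat -> R) (x : R).

Definition newton t i x : R := \prod_(l < i) (t l - x).

Fixpoint newton_coef t (j i k : nat) : R :=
  if i is i'.+1 then
    newton_coef t j i' k * (t i' - t k)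
    + (if k is k'.+1 then newton_coef t j i' k' else 0)
  else (k == j)%:R.

Lemma newtonS t i x : newton t i.+1 x = newton t i x * (t i - x).
Proof. exact: big_ord_recr. Qed.

Lemma newton_root t i k : (k < i)%N -> newton t i (t k) = 0.
Proof. by move=> ki; rewrite /newton (bigD1 (Ordinal ki)) //= subrr mul0r. Qed.

(** The vanishing of [newton t n.+1 x] makes the expansion stop at [n], whatever
    the size of [i + j]. *)
Lemma newton_mul t n i j x : (j <= n)%N -> newton t n.+1 x = 0 ->
  newton t i x * newton t j x = \sum_(k < n.+1) newton_coef t j i k * newton t k x.
Proof.
move=> jn N0; elim: i => [|i IHi].
  rewrite /newton big_ord0 mul1r (bigD1 (Ordinal (jn : (j < n.+1)%N))) //=.
  rewrite eqxx mul1r [X in _ + X]big1 ?addr0 // => k.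
  by rewrite -val_eqE /= => /negPf ->; rewrite mul0r.
rewrite newtonS mulrAC IHi mulr_suml.
under eq_bigr => k _.
  have -> : newton_coef t j i k * newton t k x * (t i - x) =
    newton_coef t j i k * (t i - t k) * newton t k x
    + newton_coef t j i k * newton t k.+1 x by rewrite newtonS; ring.
  over.
under [RHS]eq_bigr do rewrite /= mulrDl.
rewrite !big_split /=; congr (_ + _).
by rewrite big_ord_recr big_ord_recl /= N0 mulr0 addr0 mul0r add0r.
Qed.

Lemma newton_coef_lt t j i k : (k < j)%N -> newton_coef t j i k = 0.
Proof.
elim: i k => [|i IHi] k kj /=; first by rewrite ltn_eqF.
rewrite IHi // mul0r add0r; case: k kj => // k /ltnW; exact: IHi.
Qed.

Lemma newton_coef_gt t j i k : (i + j < k)%N -> newton_coef t j i k = 0.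
Proof.
elim: i k => [|i IHi] [|k] //= ijk; first by rewrite gtn_eqF.
by rewrite !IHi ?mul0r ?addr0 //; lia.
Qed.

Lemma newton_coef_diag t j i : newton_coef t j i j = newton t i (t j).
Proof.
elim: i => [|i IHi] /=; first by rewrite eqxx /newton big_ord0.
rewrite IHi newtonS; case: j {IHi} => [|j]; first by rewrite addr0.
by rewrite newton_coef_lt // addr0.
Qed.

(** Only the nodes [t_l] with [l < i], the roots of the first factor, and those
    with [j <= l <= k] enter. *)
Lemma eq_newton_coef t t' j i k :
    (forall l, (l < i)%N || (j <= l <= k)%N -> t l = t' l) ->
  newton_coef t j i k = newton_coef t' j i k.
Proof.
elim: i k => // i IHi k tt' /=; congr (_ + _); last first.
  by case: k tt' => // k tt'; apply: IHi => l lP; apply: tt'; lia.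
case: (ltnP k j) => kj; first by rewrite !newton_coef_lt ?mul0r.
by rewrite (IHi k) ?tt' ?leqnn ?kj ?orbT // => l lP; apply: tt'; lia.
Qed.

(** The divided difference in the node [t_k], where [t'] stands for [t] after the
    exchange of [t_k] and [t_(k+1)].  In the recursion, the second term of
    [c_(i+1)^k] is the same for both sequences, and the Leibniz rule for the
    first one, with [a] and [a'] the values of [c_i^k] at [t] and [t'],
      [a' (t_i - t_(k+1)) - a (t_i - t_k)
       = (a' - a) (t_i - t_(k+1)) + a (t_k - t_(k+1))],
    reproduces the recursion for [c_(i+1)^(k+1)]. *)
Lemma newton_coef_divdiff t t' j i k : (i <= k)%N -> (j <= k)%N ->
    (forall l, (l < k)%N -> t l = t' l) -> t' k = t k.+1 ->
  newton_coef t j i k.+1 * (t k - t k.+1)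
  = newton_coef t' j i k - newton_coef t j i k.
Proof.
move=> + jk tt' t'k; elim: i => [|i IHi] ik /=.
  by rewrite subrr gtn_eqF ?mul0r.
set b' := (X in _ = _ + X - _); set b := (X in _ = _ - (_ + X)).
have -> : b' = b.
  rewrite /b' /b; case: (k) ik tt' => // k' ik tt'.
  by apply/esym/eq_newton_coef => l lP; apply: tt'; lia.
rewrite -(tt' i) // t'k mulrDl mulrAC (IHi (ltnW ik)); ring.
Qed.

(** With these nodes and [k = j + m], the recursion is Pascal's rule. *)
Lemma newton_coef_binomial j i m : (i <= j)%N ->
  newton_coef (fun l => (l < j)%:R) j i (j + m) = 'C(i, m)%:R.
Proof.
elim: i m => [|i IHi] m ij /=.
  by rewrite -{2}[j]addn0 eqn_add2l bin0n.
rewrite (IHi _ (ltnW ij)) ij ltnNge leq_addr subr0 mulr1.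
case: m => [|m]; last by rewrite addnS (IHi _ (ltnW ij)) binS natrD.
rewrite addn0 !bin0; case: j {IHi ij} => [|j]; first by rewrite addr0.
by rewrite newton_coef_lt // addr0.
Qed.

End Newton.

Lemma rmorph_newton_coef (R S : comPzRingType) (f : {rmorphism R -> S}) t j i k :
  f (newton_coef t j i k) = newton_coef (f \o t) j i k.
Proof.
elim: i k => [|i IHi] k /=; first by rewrite rmorph_nat.
by rewrite rmorphD rmorphM rmorphB IHi; case: k => [|k]; rewrite ?rmorph0 ?IHi.
Qed.

(** * The weights as nodes *)

Section Projective.
Variable n : nat.

(** Indexing by [nat], with a junk value above [n], spares the recursion the
    bound on its indices. *)
Definition weight (l : nat) : HTpt n := 'X_(inord l).

Lemma weightE (k : 'I_n.+1) : weight k = 'X_k.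
Proof. by rewrite /weight inord_val. Qed.

Lemma mpolyXB_neq0 (a b : 'I_n.+1) : a != b -> 'X_a - 'X_b != 0 :> HTpt n.
Proof.
move=> ab; apply/eqP => /(congr1 (meval (fun l => (l == a)%:R : int))).
rewrite rmorphB rmorph0 /= !mevalXU eqxx eq_sym (negPf ab) subr0.
by move/eqP; rewrite oner_eq0.
Qed.

Lemma newton_weightE (i k : 'I_n.+1) :
  newton weight i (weight k) = \prod_(l < n.+1 | (l < i)%N) ('X_l - 'X_k).
Proof.
rewrite /newton (big_ord_widen n.+1 (fun l => weight l - weight k)) 1?ltnW //.
by apply: eq_bigr => l _; rewrite !weightE.
Qed.

Lemma restr_schubert (i k : 'I_n.+1) :
  restr (schubert i) k = newton weight i (weight k).
Proof.
rewrite /restr /= ffunE -newton_weightE.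
by case: leqP => // ki; rewrite newton_root.
Qed.

Lemma restr_schubert_diag_neq0 (k : 'I_n.+1) : restr (schubert k) k != 0.
Proof.
rewrite restr_schubert newton_weightE; apply/prodf_neq0 => l lk.
by apply: mpolyXB_neq0; rewrite -val_eqE ltn_eqF.
Qed.

Lemma restr_sum (I : Type) (r : seq I) (F : I -> HTP n) k :
  restr (\sum_(a <- r) F a) k = \sum_(a <- r) restr (F a) k.
Proof.
apply: (big_morph (fun p => restr p k)) => [p q|]; first exact: restrD.
by rewrite /restr /= ffunE.
Qed.

(** Restricting to [x_m], for [m] increasing, isolates the coefficient of
    [p_m]: the earlier ones agree already, and the later classes vanish there. *)
Lemma schubert_inj (c d : 'I_n.+1 -> HTpt n) :
  \sum_(k < n.+1) c k *: schubert k = \sum_(k < n.+1) d k *: schubert k ->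
  c =1 d.
Proof.
move=> cd k; have [m] := ubnP k; elim: m => // m IHm in k *; rewrite ltnS => km.
have := congr1 (fun p => restr p k) cd; rewrite !restr_sum.
rewrite (bigD1 k) //= [RHS](bigD1 k) //= !restrZ.
rewrite [X in _ + X = _](eq_bigr (fun l => restr (d l *: schubert l) k)).
  by move/addIr/(mulIf (restr_schubert_diag_neq0 k)).
move=> l lk; rewrite !restrZ; case: (ltngtP l k) => [lk'|kl|/val_inj elk].
- by rewrite IHm // (leq_trans lk').
- by rewrite restr_schubert newton_root // !mulr0.
- by rewrite elk eqxx in lk.
Qed.

Lemma schubert_mul (i j : 'I_n.+1) :
  schubert i * schubert j
  = \sum_(k < n.+1) newton_coef weight j i k *: schubert k.
Proof.
apply: restr_inj => a; rewrite restrM restr_sum !restr_schubert.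
rewrite (newton_mul _ (leq_ord j) (newton_root _ (ltn_ord a))).
by apply: eq_bigr => k _; rewrite [RHS]restrZ restr_schubert.
Qed.

Lemma newton_coef_weight_neq0 i j k : (i <= j)%N -> (j <= n)%N ->
  (j <= k <= i + j)%N -> (k <= n)%N -> newton_coef weight j i k != 0.
Proof.
move=> ij jn /andP[jk kij] kn.
apply/eqP => /(congr1 (meval (fun l : 'I_n.+1 => (l < j)%:R : int))).
rewrite rmorph0 /= rmorph_newton_coef.
rewrite (@eq_newton_coef _ _ (fun l => (l < j)%:R)); last first.
  by move=> l lP; rewrite /= mevalXU inordK //; lia.
rewrite -(subnKC jk) newton_coef_binomial // => /eqP.
by rewrite Num.Theory.pnatr_eq0 -leqn0 leqNgt bin_gt0; lia.
Qed.

(** * Divided differences of the coefficients *)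

Lemma divdiff_unique m (p q : HTpt n) : (m < n)%N ->
  q * (weight m - weight m.+1) = msym (tperm (inord m) (inord m.+1)) p - p ->
  divdiff m p = q.
Proof.
move=> mn; rewrite -divdiff2E => /esym; apply/mulIf/mpolyXB_neq0.
by rewrite -val_eqE /= !inordK ?ltn_eqF // ltnW.
Qed.

Lemma msym_weight (s : 'S_n.+1) l : msym s (weight l) = 'X_(s (inord l)).
Proof. by rewrite /msym /weight mmapX mmap1U. Qed.

Lemma divdiff_newton_coef i j k : (i <= j <= k)%N -> (k < n)%N ->
  divdiff k (newton_coef weight j i k) = newton_coef weight j i k.+1.
Proof.
move=> /andP[ij jk] kn; apply: divdiff_unique => //.
rewrite rmorph_newton_coef; apply: newton_coef_divdiff => //=.
- exact: leq_trans jk.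
- move=> l lk; rewrite msym_weight tpermD // -val_eqE /= !inordK //; lia.
- by rewrite msym_weight tpermL.
Qed.

Lemma divdiffs_newton_coef i j k : (i <= j <= k)%N -> (k <= n)%N ->
  divdiffs j k (restr (schubert (inord i)) (inord j))
  = newton_coef weight j i k.
Proof.
move=> /andP[ij jk]; rewrite -(subnKC jk) /divdiffs /index_iota addKn.
elim: (k - j)%N => [|m IHm] mn.
  by rewrite addn0 /= newton_coef_diag restr_schubert !inordK //; lia.
rewrite -[in iota _ _]addn1 iotaD foldl_cat IHm /= ?addnS; last lia.
by rewrite divdiff_newton_coef //; lia.
Qed.

End Projective.

(** * The structure constants *)

(* The first conjunct says that the expansion exists; the second determines
   the coefficients of any such expansion. *)
Theorem theorem4p1 (n : nat) (i j : 'I_n.+1) (n_ge1 : (1 <= n)%N)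
    (le_ij : (i <= j)%N) :
  (exists c : 'I_n.+1 -> HTpt n,
     schubert i * schubert j = \sum_(k < n.+1) c k *: schubert k) /\
  (forall c : 'I_n.+1 -> HTpt n,
     schubert i * schubert j = \sum_(k < n.+1) c k *: schubert k ->
     [/\ forall k : 'I_n.+1, c k <> 0 <-> (j <= k <= minn (i + j) n)%N,
         c j = restr (schubert i) j,
         restr (schubert i) j = \prod_(l < n.+1 | (l < i)%N) ('X_l - 'X_j)
       & forall k : 'I_n.+1, (j < k <= minn (i + j) n)%N ->
           c k = divdiffs j k (restr (schubert i) j)]).
Proof.
split; first by eexists; exact: schubert_mul.
move=> c; rewrite schubert_mul => /schubert_inj cE.
split.
- move=> k; rewrite -cE leq_min leq_ord andbT; split; last first.
    by move=> jk; apply/eqP/newton_coef_weight_neq0; rewrite ?leq_ord.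
  case: (ltnP k j) => [kj|_]; first by rewrite newton_coef_lt.
  by case: leqP => // ijk; rewrite newton_coef_gt.
- by rewrite -cE newton_coef_diag restr_schubert.
- by rewrite restr_schubert newton_weightE.
- move=> k /andP[jk _].
  by rewrite -cE -divdiffs_newton_coef ?inord_val ?leq_ord // le_ij ltnW.
Qed.
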